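(* Let $L$ be a finite-dimensional solvable Leibniz $A$-algebra over a field $F$. Then $L$ splits over each term of its derived series; that is, for each $i\ge 0$ there is a subalgebra $B$ of $L$ with $L=L^{(i)}\dot{+}B$. Moreover, for each $i\ge 0$, the Cartan subalgebras of $L^{(i)}/L^{(i+2)}$ are precisely the subalgebras of $L^{(i)}/L^{(i+2)}$ that are complementary (as vector subspaces) to $L^{(i+1)}/L^{(i+2)}$.
   Context: A (right) Leibniz algebra over $F$ is a vector space with a bilinear product $[\,,]$ satisfying $[x,[y,z]]=[[x,y],z]-[[x,z],y]$ for all $x,y,z$. Lower central series: $L^1=L$, $L^{k+1}=[L^k,L]$; $L$ is nilpotent if $L^k=0$ for some $k$. Derived series: $L^{(0)}=L$, $L^{(k+1)}=[L^{(k)},L^{(k)}]$; $L$ is solvable if $L^{(k)}=0$ for some $k$. $L$ is abelian if $[x,y]=0$ for all $x,y$. $L$ is an $A$-algebra if every nilpotent subalgebra of $L$ is abelian. $\dot{+}$ denotes a vector space direct sum. A Cartan subalgebra $C$ of a Leibniz algebra $M$ is a nilpotent subalgebra that equals its normaliser $\{x\in M : [x,C]\subseteq C \text{ and } [C,x]\subseteq C\}$. *)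

(* Defs.v *)
From HB Require Import structures.
From mathcomp Require Import all_boot all_order all_algebra.

Set Implicit Arguments.
Unset Strict Implicit.
Unset Printing Implicit Defensive.

Import GRing.Theory Quotient.
Local Open Scope ring_scope.
Local Open Scope quotient_scope.

(* The coset space V / I, with its finite-dimensional vector space structure. *)
Section QuotientSpace.
Variables (F : fieldType) (V : vectType F) (I : {vspace V}).

Definition quotv := Quotient.quot I.
HB.instance Definition _ := EqQuotient.on quotv.
HB.instance Definition _ := GRing.Zmodule.on quotv.

Definition quotv_pi (x : V) : quotv := \pi_quotv x.

Lemma quotv_piE x y : (quotv_pi x == quotv_pi y) = (x - y \in I).
Proof. by rewrite /quotv_pi Quotient.idealrBE. Qed.

Lemma quotv_piB : {morph quotv_pi : x y / x - y}.
Proof. by move=> x y; exact: (raddfB (\pi_quotv)). Qed.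

Lemma quotv_piD : {morph quotv_pi : x y / x + y}.
Proof. by move=> x y; exact: (raddfD (\pi_quotv)). Qed.

Lemma quotv_reprK : cancel repr quotv_pi.
Proof. exact: reprK. Qed.

Definition quotv_scale (a : F) (q : quotv) : quotv := quotv_pi (a *: repr q).

Lemma quotv_piZ a x : quotv_pi (a *: x) = quotv_scale a (quotv_pi x).
Proof.
apply/eqP; rewrite quotv_piE -scalerBr memvZ // -quotv_piE.
by rewrite quotv_reprK.
Qed.

Fact quotv_scaleA a b q :
  quotv_scale a (quotv_scale b q) = quotv_scale (a * b) q.
Proof. by rewrite -[q]quotv_reprK -!quotv_piZ scalerA. Qed.
Fact quotv_scale1 : left_id 1 quotv_scale.
Proof. by move=> q; rewrite -[q]quotv_reprK -quotv_piZ scale1r. Qed.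
Fact quotv_scaleDr : right_distributive quotv_scale +%R.
Proof.
move=> a p q; rewrite -[p]quotv_reprK -[q]quotv_reprK.
by rewrite -quotv_piD -!quotv_piZ -quotv_piD scalerDr.
Qed.
Fact quotv_scaleDl q : {morph quotv_scale^~ q : a b / a + b}.
Proof.
by move=> a b; rewrite -[q]quotv_reprK -!quotv_piZ -quotv_piD scalerDl.
Qed.
HB.instance Definition _ := GRing.Zmodule_isLmodule.Build F quotv
  quotv_scaleA quotv_scale1 quotv_scaleDr quotv_scaleDl.

Fact quotv_pi_linear : linear quotv_pi.
Proof. by move=> a x y; rewrite quotv_piD quotv_piZ. Qed.
HB.instance Definition _ :=
  GRing.isSemilinear.Build F V quotv _ quotv_pi
    (GRing.semilinear_linear quotv_pi_linear).

Lemma quotv_pi_eq0 x : (quotv_pi x == 0) = (x \in I).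
Proof. by rewrite -(raddf0 quotv_pi) quotv_piE subr0. Qed.

Import VectorInternalTheory.

(* I^C is a linear transversal of the cosets of I.                            *)
Let proj_compl (x : V) : subvs_of I^C := vsproj I^C (x - projv I x).

Fact quotv_vect_axiom : Vector.axiom (dim (subvs_of I^C)) quotv.
Proof.
have pE x : vsval (proj_compl x) = x - projv I x.
  by rewrite /proj_compl vsprojK ?memv_projC.
have pL : linear proj_compl.
  move=> a x y; rewrite /proj_compl -linearP scalerBr.
  by congr (vsproj _ _); rewrite linearP opprD addrACA.
have pW x y : x - y \in I -> proj_compl x = proj_compl y.
  move/projv_id; rewrite linearB => e; apply: val_inj; rewrite /= !pE.
  by apply/eqP; rewrite -subr_eq0 opprD opprK addrACA -e addrACA subrr add0r
                        addNr.
have reprI x : repr (quotv_pi x) - x \in I.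
  by rewrite -quotv_piE quotv_reprK.
pose f (q : quotv) := v2r (proj_compl (repr q)).
exists f.
  move=> a p q; rewrite /f -linearP -pL; congr (v2r _); apply: pW.
  by rewrite -quotv_piE quotv_pi_linear !quotv_reprK.
exists (fun r => quotv_pi (vsval (r2v r))) => [q | r]; rewrite /f.
  rewrite v2rK pE; apply/eqP; rewrite -[q in _ == q]quotv_reprK quotv_piE.
  by rewrite addrAC subrr add0r memvN memv_proj.
rewrite (pW _ _ (reprI _)); apply: (canLR r2vK); apply: val_inj; rewrite /= pE.
have : vsval (r2v r) \in lker (projv I) by rewrite lker_proj; exact: subvsP.
by rewrite memv_ker => /eqP->; rewrite subr0.
Qed.
HB.instance Definition _ := Lmodule_hasFinDim.Build F quotv quotv_vect_axiom.

Definition quotv_img (W : {vspace V}) : {vspace quotv} :=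
  (linfun quotv_pi @: W)%VS.

Lemma mem_quotv_img (W : {vspace V}) q :
  reflect (exists2 x, x \in W & q = quotv_pi x) (q \in quotv_img W).
Proof.
by apply: (iffP memv_imgP) => -[x Wx ->]; exists x => //; rewrite lfunE.
Qed.

End QuotientSpace.

(* Leibniz algebras are given by a bracket br on a finite-dimensional vector  *)
(* space; subalgebras, ideals and the series are subspaces.                   *)
Section LeibnizDefs.
Variables (F : fieldType) (L : vectType F) (br : L -> L -> L).
Implicit Types (U V I B C N : {vspace L}).

Record leibniz_bracket : Prop := LeibnizBracket {
  lbr_linearl : forall y, linear (br^~ y);
  lbr_linearr : forall x, linear (br x);
  lbr_identity : forall x y z, br x (br y z) = br (br x y) z - br (br x z) y
}.

(* [U, V] is the span of all brackets; see lbrvP and memv_lbrv.               *)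
Definition lbrv U V : {vspace L} :=
  <<[seq br u v | u <- vbasis U, v <- vbasis V]>>%VS.

Definition subalgebra B : Prop := forall x y, x \in B -> y \in B -> br x y \in B.

Definition ideal I : Prop :=
  forall x u, u \in I -> br x u \in I /\ br u x \in I.

(* lower_central N k is the term N^(k+1) of the series starting at N^1 = N.   *)
Definition lower_central N (k : nat) : {vspace L} :=
  iter k (fun V => lbrv V N) N.

Definition nilpotent N : Prop := exists k, lower_central N k = 0%VS.

Definition derived (k : nat) : {vspace L} :=
  iter k (fun V => lbrv V V) fullv.

Definition solvable : Prop := exists k, derived k = 0%VS.

Definition abelian U : Prop := forall x y, x \in U -> y \in U -> br x y = 0.

Definition A_algebra : Prop :=
  forall N, subalgebra N -> nilpotent N -> abelian N.

Definition in_normaliser C (x : L) : Prop :=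
  forall c, c \in C -> br x c \in C /\ br c x \in C.

Definition cartan C : Prop :=
  [/\ subalgebra C, nilpotent C & forall x, x \in C <-> in_normaliser C x].

Definition complementary U V : Prop :=
  (U + V)%VS = fullv /\ (U :&: V)%VS = 0%VS.

Hypothesis brL : leibniz_bracket.

Lemma lbrDl x y z : br (x + y) z = br x z + br y z.
Proof. by have := lbr_linearl brL z 1 x y; rewrite !scale1r. Qed.

Lemma lbrDr x y z : br x (y + z) = br x y + br x z.
Proof. by have := lbr_linearr brL x 1 y z; rewrite !scale1r. Qed.

Lemma lbr0l x : br 0 x = 0.
Proof. by apply: (addrI (br 0 x)); rewrite -lbrDl !addr0. Qed.

Lemma lbr0r x : br x 0 = 0.
Proof. by apply: (addrI (br x 0)); rewrite -lbrDr !addr0. Qed.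

Lemma lbrZl a x y : br (a *: x) y = a *: br x y.
Proof. by have := lbr_linearl brL y a x 0; rewrite lbr0l !addr0. Qed.

Lemma lbrZr a x y : br x (a *: y) = a *: br x y.
Proof. by have := lbr_linearr brL x a y 0; rewrite lbr0r !addr0. Qed.

Lemma lbrBl x y z : br (x - y) z = br x z - br y z.
Proof. by rewrite lbrDl -scaleN1r lbrZl scaleN1r. Qed.

Lemma lbrBr x y z : br x (y - z) = br x y - br x z.
Proof. by rewrite lbrDr -scaleN1r lbrZr scaleN1r. Qed.

Lemma memv_lbrv U V u v : u \in U -> v \in V -> br u v \in lbrv U V.
Proof.
move=> /coord_vbasis-> /coord_vbasis->.
elim/big_rec: _ => [|i x _ IH]; first by rewrite lbr0l mem0v.
rewrite lbrDl lbrZl memvD // memvZ //.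
elim/big_rec: _ => [|j y _ IH']; first by rewrite lbr0r mem0v.
rewrite lbrDr lbrZr memvD // memvZ // memv_span //.
by apply/allpairsP; exists ((vbasis U)`_i, (vbasis V)`_j);
   rewrite !mem_nth ?size_tuple.
Qed.

Lemma lbrvP U V (W : {vspace L}) :
  reflect (forall u v, u \in U -> v \in V -> br u v \in W)
          (lbrv U V <= W)%VS.
Proof.
apply: (iffP idP) => [sW u v uU vV | sW].
  exact: subvP sW _ (memv_lbrv uU vV).
apply/span_subvP=> _ /allpairsP[[u v] /= [uU vV ->]].
by apply: sW; apply: vbasis_mem.
Qed.

Lemma lbrv_ind U V (P : L -> Prop) :
    P 0 -> (forall a x y, P x -> P y -> P (a *: x + y)) ->
    (forall u v, u \in U -> v \in V -> P (br u v)) ->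
  forall w, w \in lbrv U V -> P w.
Proof.
move=> P0 PD Pb w /(coord_span (X := in_tuple _))->.
elim/big_rec: _ => // i x _ Px; apply: PD => //.
have /allpairsP[[u v] /= [uU vV ->]] :
  (in_tuple [seq br u v | u <- vbasis U, v <- vbasis V])`_i
    \in [seq br u v | u <- vbasis U, v <- vbasis V] by apply: mem_nth.
by apply: Pb; apply: vbasis_mem.
Qed.

Lemma ideal_lbrv I : ideal I -> ideal (lbrv I I).
Proof.
move=> idI x; apply: lbrv_ind => [|a u v [xu ux] [xv vx]|u v Iu Iv].
- by rewrite lbr0l lbr0r mem0v.
- by rewrite lbrDl lbrDr lbrZl lbrZr !memvD ?memvZ.
have [xu ux] := idI x u Iu; have [xv vx] := idI x v Iv; split.
  by rewrite (lbr_identity brL) memvB // memv_lbrv.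
have -> : br (br u v) x = br u (br v x) + br (br u x) v.
  by rewrite (lbr_identity brL) subrK.
by rewrite memvD // memv_lbrv.
Qed.

Lemma derived_ideal k : ideal (derived k).
Proof.
elim: k => [|k IHk]; last exact: ideal_lbrv.
by move=> x u _; rewrite !memvf.
Qed.

Lemma derived_subalgebra k : subalgebra (derived k).
Proof. by move=> x y _ /derived_ideal-/(_ x)[]. Qed.

Lemma derivedS k : (derived k.+1 <= derived k)%VS.
Proof. by apply/lbrvP => u v _ /derived_ideal-/(_ u)[]. Qed.

End LeibnizDefs.

(* The bracket induced on a subalgebra U. The projection vsproj U is the      *)
(* identity on U, hence invisible when U is a subalgebra (vsval_sub_br).      *)
Section SubAlgebra.
Variables (F : fieldType) (L : vectType F) (br : L -> L -> L).
Variable U : {vspace L}.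

Definition sub_br (x y : subvs_of U) : subvs_of U :=
  vsproj U (br (vsval x) (vsval y)).

(* W :&: U, seen as a subspace of U.                                          *)
Definition subv_in (W : {vspace L}) : {vspace subvs_of U} :=
  (linfun vsval @^-1: W)%VS.

Lemma mem_subv_in W x : (x \in subv_in W) = (vsval x \in W).
Proof. by rewrite -memv_preim lfunE. Qed.

Hypothesis subU : subalgebra br U.

Lemma vsval_sub_br x y : vsval (sub_br x y) = br (vsval x) (vsval y).
Proof. by rewrite vsprojK // subU ?subvsP. Qed.

Lemma sub_br_leibniz : leibniz_bracket br -> leibniz_bracket sub_br.
Proof.
move=> brL; split=> [y a u v|x a u v|x y z]; apply: val_inj.
- by rewrite /= vsval_sub_br !linearP /= !vsval_sub_br (lbr_linearl brL).
- by rewrite /= vsval_sub_br !linearP /= !vsval_sub_br (lbr_linearr brL).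
by rewrite /= !vsval_sub_br (lbr_identity brL).
Qed.

Lemma subv_in_ideal W : ideal br W -> ideal sub_br (subv_in W).
Proof. by move=> idW x u; rewrite !mem_subv_in !vsval_sub_br; apply: idW. Qed.

End SubAlgebra.

(* The bracket induced on the quotient by an ideal I, computed on             *)
(* representatives; quotv_pi_br is the independence of their choice.          *)
Section QuotientAlgebra.
Variables (F : fieldType) (L : vectType F) (br : L -> L -> L).
Variable I : {vspace L}.

Definition quotv_br (p q : quotv I) : quotv I :=
  quotv_pi I (br (repr p) (repr q)).

Hypotheses (brL : leibniz_bracket br) (idI : ideal br I).

Lemma quotv_pi_br x y :
  quotv_br (quotv_pi I x) (quotv_pi I y) = quotv_pi I (br x y).
Proof.
have reprI z : repr (quotv_pi I z) - z \in I by rewrite -quotv_piE quotv_reprK.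
apply/eqP; rewrite quotv_piE -[_ - _](subrKA (br x (repr (quotv_pi I y)))).
by rewrite -(lbrBl brL) -(lbrBr brL) memvD //;
   [case: (idI (repr (quotv_pi I y)) (reprI x)) | case: (idI x (reprI y))].
Qed.

Lemma quotv_br_leibniz : leibniz_bracket quotv_br.
Proof.
split=> [y a u v|x a u v|x y z].
- rewrite -[y]quotv_reprK -[u]quotv_reprK -[v]quotv_reprK.
  by rewrite -linearP !quotv_pi_br (lbr_linearl brL) linearP.
- rewrite -[x]quotv_reprK -[u]quotv_reprK -[v]quotv_reprK.
  by rewrite -linearP !quotv_pi_br (lbr_linearr brL) linearP.
rewrite -[x]quotv_reprK -[y]quotv_reprK -[z]quotv_reprK.
by rewrite !quotv_pi_br (lbr_identity brL) linearB.
Qed.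

End QuotientAlgebra.

(* U / I for a subalgebra U of L and an ideal I of U.                         *)
Section SubQuotient.
Variables (F : fieldType) (L : vectType F) (br : L -> L -> L).
Variables U I : {vspace L}.

Definition subquo : vectType F := quotv (subv_in U I).

Definition subquo_br : subquo -> subquo -> subquo :=
  quotv_br (sub_br br (U := U)) (I := subv_in U I).

(* W / I, for I <= W <= U.                                                    *)
Definition subquo_img (W : {vspace L}) : {vspace subquo} :=
  quotv_img (subv_in U I) (subv_in U W).

Lemma subquo_br_leibniz :
  leibniz_bracket br -> subalgebra br U -> ideal br I ->
  leibniz_bracket subquo_br.
Proof.
move=> brL subU idI; apply: quotv_br_leibniz; first exact: sub_br_leibniz.
exact: subv_in_ideal.
Qed.

End SubQuotient.
Arguments subquo_br {F L} br U I.

Lemma derived_subquo_leibniz (F : fieldType) (L : vectType F)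
    (br : L -> L -> L) i j :
  leibniz_bracket br ->
  leibniz_bracket (subquo_br br (derived br i) (derived br j)).
Proof.
by move=> brL; apply: subquo_br_leibniz => //;
   [exact: derived_subalgebra | exact: derived_ideal].
Qed.

(* Main.v *)
Require Import Defs.
From HB Require Import structures.
From mathcomp Require Import all_boot all_order all_algebra.

(* Write R_y for the right multiplication x |-> [x, y], a derivation. If M is *)
(* an ideal of S whose derived algebra M' is abelian, then for y in M all     *)
(* multiplications by elements of M commute with R_y on M', and the Fitting   *)
(* decomposition S = S0 + S1 of R_y has S1 <= M', S0 a subalgebra and         *)
(* M' = (M :&: S0)' + S1. This allows induction on \dim S, until every R_y is *)
(* nilpotent on S for y in a basis of M; then M is nilpotent, hence abelian   *)
(* by the A-property, and M' = 0. So S splits over M', and no nonzero element *)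
(* of M' is killed by M. Taking M to be the last but one nonzero term of the  *)
(* derived series and passing to the complement gives the splitting over all  *)
(* terms; no Cartan subalgebra is needed, which matters over small fields.    *)
(* For a Cartan subalgebra C of a metabelian A-algebra S the same induction,  *)
(* with y in C, shows that C is complementary to S'; in the nilpotent case    *)
(* S' + C is nilpotent, hence abelian, so that S' normalises C. Finally       *)
(* L^(i) / L^(i+2) is isomorphic to a complement of L^(i+2) in L^(i), hence   *)
(* is again an A-algebra.                                                     *)

Set Implicit Arguments.
Unset Strict Implicit.
Unset Printing Implicit Defensive.

Import GRing.Theory.
Local Open Scope ring_scope.

(** The induction on dimension rests on [metabelian_fitting]: S1 lies in M', so by [direct_trans] a
    complement of (M :&: S0)' in S0 is also a complement of M' in S. When no R_y splits off a
    nonzero S1, [commuting_nilpotent] takes the place of Engel's theorem and the A-property ends the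
    induction. It is run twice, in [metabelian_ideal_splits] and [metabelian_cartan_complement].

    If J is the last nonzero derived term and S = J + B, then S^(i) = J + B^(i), so a complement of
    B^(i) in B also serves S^(i) ([derived_of_splits]). Conversely, in the metabelian case a
    complement C of L' is abelian, and the L'-component of an element normalising C is killed by L,
    hence zero ([metabelian_cartanP]). [subquo_A_algebra] makes this applicable to the quotients. *)

(** * Stabilisation of chains and the Fitting decomposition *)

Lemma iter_stable (F : fieldType) (V : vectType F)
    (g : {vspace V} -> {vspace V}) (A : {vspace V}) :
  (forall k, iter k.+1 g A <= iter k g A)%VS ->
  exists n, iter n.+1 g A = iter n g A.
Proof.
move=> dec.
(* The dimension drops at each step until the chain stabilises, so k = \dim A + 1 leaves only the
   first alternative. *)
have H k : (exists n, iter n.+1 g A = iter n g A)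
           \/ (\dim (iter k g A) + k <= \dim A)%N.
  elim: k => [|k [|IH]]; [by right; rewrite addn0 | by left |].
  have [e|ne] := eqVneq (iter k.+1 g A) (iter k g A); first by left; exists k.
  right; apply: leq_trans IH; rewrite addnS -addSn leq_add2r.
  rewrite ltn_neqAle dimvS // andbT; apply: contra ne => e.
  by rewrite eqEdim dec (eqP e) /=.
case: (H (\dim A).+1) => // le; move: (leq_trans (leq_addl _ _) le).
by rewrite ltnn.
Qed.

Lemma iter_additive (V : zmodType) (f : V -> V) n :
  {morph f : x y / x + y} -> {morph iter n f : x y / x + y}.
Proof. by move=> fD x y; elim: n => //= n ->. Qed.

Section Fitting.
Variables (F : fieldType) (V : vectType F) (f : V -> V) (S : {vspace V}).
Hypotheses (lf : linear f) (fS : forall x, x \in S -> f x \in S).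

(** [I] is the stable image and [K] the union of the kernels of the powers of f on S. Elements of
    [I] are preimaged under every power, because exponents beyond n are needed later. *)
Lemma fitting : exists (K I : {vspace V}) (n : nat),
  [/\ (K + I = S)%VS, (K :&: I = 0)%VS,
      forall x, x \in K <-> x \in S /\ exists k, iter k f x = 0,
      forall k x, x \in I -> exists2 s, s \in S & x = iter k f s
    & forall s, s \in S -> iter n f s \in I].
Proof.
pose fL : {linear V -> V} := HB.pack f (GRing.isLinear.Build F V V _ f lf).
pose h := linfun fL; pose g k := iter k (fun u => h \o u)%VF \1%VF.
have gE k x : g k x = iter k f x.
  by elim: k => [|k IH] /=; rewrite ?id_lfunE // comp_lfunE IH lfunE.
have imgE k : iter k (fun W => h @: W)%VS S = (g k @: S)%VS.
  by elim: k => [|k IH] /=; rewrite ?lim1g // IH limg_comp.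
have iS k x : x \in S -> iter k f x \in S.
  by move=> xS; elim: k => //= k; apply: fS.
have dec k : (iter k.+1 (fun W => h @: W) S <= iter k (fun W => h @: W) S)%VS.
  rewrite !imgE; apply/subvP => _ /memv_imgP[x xS ->].
  by rewrite gE iterSr -gE memv_img // fS.
have [n] := iter_stable dec; rewrite /= imgE => st.
have stk k : (g (k + n)%N @: S)%VS = (g n @: S)%VS.
  by elim: k => // k IH; rewrite addSn -imgE /= imgE IH st.
have inI k x : x \in (g n @: S)%VS -> exists2 s, s \in S & x = iter k f s.
  rewrite -(stk k) => /memv_imgP[s sS ->].
  by exists (iter n f s); rewrite ?iS // gE iterD.
have inj : (g n @: S :&: lker h = 0)%VS.
  by apply/eqP; rewrite -dimv_eq0 -(eqn_add2r (\dim (h @: (g n @: S)))%VS)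
                        limg_ker_dim st add0n.
have injk k x : x \in (g n @: S)%VS -> iter k f x = 0 -> x = 0.
  elim: k x => //= k IH x xI; rewrite -iterS iterSr => /IH e.
  apply/eqP; rewrite -memv0 -inj memv_cap xI memv_ker lfunE /= e //.
  by rewrite -st -[f x](lfunE fL) memv_img.
have kerE x :
    x \in (S :&: lker (g n))%VS <-> x \in S /\ exists k, iter k f x = 0.
  rewrite memv_cap memv_ker; split=> [/andP[-> /eqP e]|[xS [k e]]].
    by split=> //; exists n; rewrite -gE.
  rewrite xS; apply/eqP/(injk k); first exact: memv_img.
  rewrite gE -iterD addnC iterD e; elim: (n) => //= j ->.
  exact: (raddf0 fL).
exists (S :&: lker (g n))%VS, (g n @: S)%VS, n; split=> //.
- apply/eqP; rewrite eqEsubv subv_add capvSl /=; apply/andP; split.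
    by apply/subvP=> _ /memv_imgP[s sS ->]; rewrite gE iS.
  apply/subvP=> s sS; have /(inI (n + n))[t tS e] : g n s \in (g n @: S)%VS.
    exact: memv_img.
  rewrite -(subrK (g n t) s) memv_add ?memv_img // memv_cap memv_ker linearB.
  by rewrite /= e iterD -!gE subrr eqxx gE memvB // iS.
- apply/eqP; rewrite -subv0; apply/subvP => x; rewrite memv_cap memv0.
  by case/andP=> /kerE[_ [k e]] xI; apply/eqP/(injk k).
by move=> s sS; rewrite -gE memv_img.
Qed.

End Fitting.

(** * Right multiplications as derivations *)

Section BracketTheory.
Variables (F : fieldType) (L : vectType F) (br : L -> L -> L).
Hypothesis brL : leibniz_bracket br.
Implicit Types (x y z : L) (A B C I M N S U V W : {vspace L}).

Lemma rbr_derivation x y z : br (br x y) z = br (br x z) y + br x (br y z).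
Proof. by rewrite (lbr_identity brL) addrC subrK. Qed.

Lemma iter_rbr0 k z : iter k (br^~ z) 0 = 0.
Proof. by elim: k => //= k ->; rewrite (lbr0l brL). Qed.

(** The Leibniz rule for R_z, by induction on n + m; it makes the Fitting null component a
    subalgebra. *)
Lemma iter_rbr_nil n m x y z :
  iter n (br^~ z) x = 0 -> iter m (br^~ z) y = 0 ->
  iter (n + m) (br^~ z) (br x y) = 0.
Proof.
have rD : {morph br^~ z : u v / u + v} by move=> u v; apply: lbrDl.
move: {2 3}(n + m)%N (erefl (n + m)%N) => k.
elim: k n m x y => [|k IH] [|n] [|m] x y // e xn ym.
- by rewrite (xn : x = 0) (lbr0l brL) iter_rbr0.
- by rewrite (xn : x = 0) (lbr0l brL) iter_rbr0.
- by rewrite (ym : y = 0) (lbr0r brL) iter_rbr0.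
rewrite iterSr rbr_derivation iter_additive //.
case: e => e; rewrite (IH n m.+1) -?iterSr // (IH n.+1 m) ?addr0 -?iterSr //.
by rewrite -e addnS.
Qed.

Lemma subv_lbrv U U' V V' :
  (U <= U')%VS -> (V <= V')%VS -> (lbrv br U V <= lbrv br U' V')%VS.
Proof.
move=> /subvP sU /subvP sV; apply/(lbrvP brL) => u v uU vV.
by rewrite (memv_lbrv brL) ?sU ?sV.
Qed.

Lemma lbrv0P U V :
  reflect (forall u v, u \in U -> v \in V -> br u v = 0) (lbrv br U V == 0%VS).
Proof.
rewrite -subv0; apply: (iffP (lbrvP brL _ _ _)) => h u v uU vV.
  by apply/eqP; rewrite -memv0 h.
by rewrite h // mem0v.
Qed.

End BracketTheory.

(** * Fitting components and nilpotency inside an ideal with abelian derived algebra *)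

Section MetabelianFitting.
Variables (F : fieldType) (L : vectType F) (br : L -> L -> L).
Hypothesis brL : leibniz_bracket br.
Implicit Types (x y z : L) (A B C I M N S U V W : {vspace L}).

Definition relative_ideal S M : Prop :=
  forall x u, x \in S -> u \in M -> br x u \in M /\ br u x \in M.

(** The two sides differ by [a, [x, y]], a bracket of two elements of the abelian M'. *)
Lemma rbr_comm M x y a :
  lbrv br (lbrv br M M) (lbrv br M M) = 0%VS -> x \in M -> y \in M ->
  a \in lbrv br M M -> br (br a x) y = br (br a y) x.
Proof.
move=> /eqP/(lbrv0P brL) abM xM yM aM; apply/eqP; rewrite -subr_eq0.
by rewrite -(lbr_identity brL) abM // memv_lbrv.
Qed.

Lemma lbr_rbr_comm M x y a :
  lbrv br (lbrv br M M) (lbrv br M M) = 0%VS -> x \in M -> y \in M ->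
  a \in lbrv br M M -> br x (br a y) = br (br x a) y.
Proof.
move=> /eqP/(lbrv0P brL) abM xM yM aM.
by rewrite (lbr_identity brL) (abM (br x y)) ?subr0 // memv_lbrv.
Qed.

(* S0 and S1 are the Fitting null and one components of R_y on S. *)
Record fitting_split S M y S0 S1 : Prop := FittingSplit {
  fs_sum : (S0 + S1 = S)%VS;
  fs_cap : (S0 :&: S1 = 0)%VS;
  fs_sub : subalgebra br S0;
  fs_null : forall x, x \in S0 <-> x \in S /\ exists k, iter k (br^~ y) x = 0;
  fs_one : (S1 <= lbrv br M M)%VS;
  fs_lbrv : (lbrv br (M :&: S0) (M :&: S0) + S1 = lbrv br M M)%VS
}.

Lemma metabelian_fitting S M y :
  subalgebra br S -> relative_ideal S M -> (M <= S)%VS ->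
  lbrv br (lbrv br M M) (lbrv br M M) = 0%VS -> y \in M ->
  exists S0 S1 n, fitting_split S M y S0 S1 /\
    forall s, s \in S -> iter n (br^~ y) s \in S1.
Proof.
move=> algS idM sMS abM yM.
have yS : y \in S := subvP sMS _ yM.
have [|K [I [n [KI KI0 inK inI toI]]]] :=
  @fitting _ _ (br^~ y) S (lbr_linearl brL y).
  by move=> x xS; apply: algS.
have sKS : (K <= S)%VS by rewrite -KI addvSl.
have sIS : (I <= S)%VS by rewrite -KI addvSr.
have sIM : (I <= lbrv br M M)%VS.
  apply/subvP=> x /(inI 2)[s sS ->] /=; rewrite memv_lbrv //.
  by have [] := idM s y sS yM.
have sMM : (lbrv br M M <= M)%VS.
  by apply/(lbrvP brL) => u v uM vM; have [] := idM v u (subvP sMS _ vM) uM.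
have iter_br k u a : u \in M -> a \in lbrv br M M ->
    [/\ iter k (br^~ y) a \in lbrv br M M,
        br (iter k (br^~ y) a) u = iter k (br^~ y) (br a u)
      & br u (iter k (br^~ y) a) = iter k (br^~ y) (br u a)].
  move=> uM aM; elim: k => //= k [IH1 IH2 IH3].
  split; first by rewrite memv_lbrv // (subvP sMM).
    by rewrite (rbr_comm abM) // IH2.
  by rewrite (lbr_rbr_comm abM) // IH3.
have idI u x : u \in M -> x \in I -> br x u \in I /\ br u x \in I.
  (* Two applications of R_y bring s into M', where multiplication by u commutes with R_y; the other
     n bring the result back into [I]. *)
  move=> uM /(inI (n + 2)%N)[s sS ->]; rewrite iterD.
  have aM : iter 2 (br^~ y) s \in lbrv br M M.
    by rewrite memv_lbrv //; have [] := idM s y sS yM.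
  have [_ -> ->] := iter_br n u _ uM aM.
  have aS := subvP sMS _ (subvP sMM _ aM).
  by split; apply: toI; apply: algS => //; apply: subvP sMS _ uM.
exists K, I, n; split=> //; split=> //; last first.
  apply/eqP; rewrite eqEsubv subv_add subv_lbrv ?capvSl //= sIM /=.
  have split u : u \in M ->
      exists k i, [/\ k \in (M :&: K)%VS, i \in I & u = k + i].
    move=> uM; have := subvP sMS _ uM; rewrite -KI => /memv_addP[k kK [i iI e]].
    exists k, i; split=> //; rewrite memv_cap kK andbT.
    by rewrite -(addrK i k) -e memvB // (subvP sMM) // (subvP sIM).
  apply/(lbrvP brL) => u v /split[k [i [kK iI ->]]] vM.
  rewrite (lbrDl brL); apply: memvD; last first.
    by apply: subvP (addvSr _ _) _ _; have [] := idI v i vM iI.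
  have [k' [i' [k'K i'I ->]]] := split v vM.
  rewrite (lbrDr brL) memv_add ?memv_lbrv //.
  by have [] := idI k i' (subvP (capvSl _ _) _ kK) i'I.
move=> u v /inK[uS [k uk]] /inK[vS [l vl]]; apply/inK; split.
  exact: algS.
by exists (k + l)%N; apply: iter_rbr_nil.
Qed.

(** A substitute for Engel's theorem. Nilpotency is asked of the generators only, so a basis
    suffices. *)
Lemma commuting_nilpotent (X : seq L) A :
    (forall x a, x \in X -> a \in A -> br a x \in A) ->
    (forall x y a, x \in X -> y \in X -> a \in A ->
       br (br a x) y = br (br a y) x) ->
    (forall x, x \in X ->
       exists k, forall a, a \in A -> iter k (br^~ x) a = 0) ->
  exists k, iter k (fun V => lbrv br V <<X>>) A = 0%VS.
Proof.
move=> sA cA nA; pose g V := lbrv br V <<X>>%VS.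
have span_ind Y (P : L -> Prop) :
    P 0 -> (forall a x y, P x -> P y -> P (a *: x + y)) ->
    (forall y, y \in Y -> P y) -> forall y, y \in <<Y>>%VS -> P y.
  move=> P0 PD PY y /(coord_span (X := in_tuple _))->.
  by elim/big_rec: _ => // i u _ Pu; apply: PD => //; apply/PY/mem_nth.
have sgA : (g A <= A)%VS.
  apply/(lbrvP brL)=> u v uA; move: v; apply: span_ind => [|a x y ax ay|x].
  - by rewrite (lbr0r brL) mem0v.
  - by rewrite (lbr_linearr brL) memvD // memvZ.
  by move=> xX; apply: sA.
have dec k : (iter k.+1 g A <= iter k g A)%VS.
  by elim: k => //= k IH; rewrite subv_lbrv.
(* Let the iterated brackets of A by X stabilise at W = [W, X]. Generators x   *)
(* are dropped from X one by one: put W' = [W, X minus x]; then [W', x] <= W'  *)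
(* and W = [W, x] + W' give W = W R_x^k + W' for all k, hence W = W'.          *)
have [n] := iter_stable dec; set W := iter n g A => stW.
have {stW}stW : g W = W := stW.
have sWA : (W <= A)%VS.
  by rewrite /W; elim: (n) => // k; apply: subv_trans (dec k).
exists n; rewrite -/g -/W; apply/eqP; rewrite -subv0.
have : (W <= lbrv br W <<X>>)%VS by rewrite -[X in (X <= _)%VS]stW.
have : {subset X <= X} by [].
elim: {-2}X => [_|x Y IH sYX sW].
  move/subv_trans; apply; rewrite span_nil; apply/(lbrvP brL) => u v _.
  by rewrite memv0 => /eqP->; rewrite (lbr0r brL) mem0v.
have xX : x \in X by rewrite sYX ?mem_head.
have {}sYX : {subset Y <= X} by move=> y yY; rewrite sYX // inE yY orbT.
apply: IH => //; set W' := lbrv br W <<Y>>.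
have W'x : forall w, w \in W' -> br w x \in W'.
  apply: lbrv_ind => [|a u v ux vx|w y wW].
  - by rewrite (lbr0l brL) mem0v.
  - by rewrite (lbr_linearl brL) memvD // memvZ.
  move=> yY; have -> : br (br w y) x = br (br w x) y.
    move: y yY; apply: span_ind => [|a u v ux vx|y yY].
    - by rewrite !(lbr0r brL) (lbr0l brL).
    - rewrite (lbr_linearr brL w a) (lbr_linearl brL x a) ux vx.
      by rewrite (lbr_linearr brL).
    by apply: cA; [exact: sYX | | exact: subvP sWA _ wW].
  by rewrite memv_lbrv // -stW memv_lbrv // memv_span.
have stepW k w : w \in W ->
    exists w1 w2, [/\ w1 \in W, w2 \in W' & w = iter k (br^~ x) w1 + w2].
  elim: k w => [|k IH] w wW.
    by exists w, 0; rewrite addr0 mem0v.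
  have [w1 [w2 [/(subvP sW) w1W w2W ->]]] := IH w wW.
  have {w1 w1W} [w3 [w4 [w3W w4W' ->]]] : exists w3 w4,
      [/\ w3 \in W, w4 \in W' & w1 = br w3 x + w4].
    move: w1 w1W; apply: lbrv_ind => [|a u v|u v uW].
    - by exists 0, 0; rewrite !mem0v (lbr0l brL) addr0.
    - move=> [u3 [u4 [uW uW' ->]]] [v3 [v4 [vW vW' ->]]].
      exists (a *: u3 + v3), (a *: u4 + v4).
      rewrite !memvD ?memvZ //; split=> //.
      by rewrite (lbr_linearl brL) scalerDr addrACA.
    rewrite span_cons => /memv_addP[_ /vlineP[a ->] [v' v'Y ->]].
    exists (a *: u), (br u v'); rewrite memvZ // memv_lbrv //; split=> //.
    by rewrite (lbrDr brL) (lbrZr brL) (lbrZl brL).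
  exists w3, (iter k (br^~ x) w4 + w2); split=> //.
    by rewrite memvD //; elim: (k) => //= j; apply: W'x.
  rewrite iter_additive; last by move=> u v; apply: lbrDl.
  by rewrite -iterSr addrA.
have [k nk] := nA x xX.
apply/subvP=> w /(stepW k)[w1 [w2 [/(subvP sWA)/nk-> w2W' ->]]].
by rewrite add0r.
Qed.

End MetabelianFitting.

(** A case split without excluded middle. *)
Lemma seq_dichotomy (T : eqType) (P Q : T -> Prop) (s : seq T) :
  (forall x, x \in s -> P x \/ Q x) ->
  (exists2 x, x \in s & P x) \/ (forall x, x \in s -> Q x).
Proof.
elim: s => [|x s IH] PQ; first by right.
have [Px|Qx] := PQ x (mem_head x s); first by left; exists x; rewrite ?mem_head.
case: IH => [y ys|[y ys Py]|sQ].
- by apply: PQ; rewrite inE ys orbT.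
- by left; exists y; rewrite // inE ys orbT.
by right=> y /[!inE]/orP[/eqP-> //|]; apply: sQ.
Qed.

(** * Direct sums of subspaces *)

Section DirectSums.
Variables (F : fieldType) (L : vectType F).
Implicit Types (A B S U V W : {vspace L}).

(** Dedekind's modular law. *)
Lemma direct_mem U V W x :
  (U <= V)%VS -> (V :&: W = 0)%VS -> x \in (U + W)%VS -> x \in V -> x \in U.
Proof.
move=> /subvP sUV VW0 /memv_addP[u uU [w wW ->]] uwV.
have : w \in (V :&: W)%VS.
  by rewrite memv_cap wW andbT -[w](addKr u) addrC memvB // sUV.
by rewrite VW0 memv0 => /eqP->; rewrite addr0.
Qed.

Lemma direct_trans U V W B S :
  (U + B = V)%VS -> (U :&: B = 0)%VS -> (V + W = S)%VS -> (V :&: W = 0)%VS ->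
  (U + W + B = S)%VS /\ ((U + W) :&: B = 0)%VS.
Proof.
move=> UB UB0 VW VW0; split; first by rewrite -addvA [(W + B)%VS]addvC addvA UB.
apply/eqP; rewrite -subv0 -UB0; apply/subvP => x; rewrite !memv_cap.
case/andP=> xUW xB; rewrite xB andbT; apply: direct_mem VW0 xUW _.
  by rewrite -UB addvSl.
by rewrite -UB (subvP (addvSr _ _)).
Qed.

End DirectSums.

(** * Splitting and Cartan subalgebras in the metabelian case *)

Section MetabelianAalgebra.
Variables (F : fieldType) (L : vectType F) (br : L -> L -> L).
Hypothesis brL : leibniz_bracket br.
Implicit Types (x y z : L) (A B C I M N S U V W : {vspace L}).

(** Either some basis vector of [X] has S1 nonzero, and induction applies to S0, or they all act
    nilpotently on S. [X] will be M for the splitting and C for Cartan subalgebras. *)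
Lemma fitting_dichotomy S M X :
  subalgebra br S -> relative_ideal br S M -> (M <= S)%VS ->
  lbrv br (lbrv br M M) (lbrv br M M) = 0%VS -> (X <= M)%VS ->
  (exists2 y, y \in X & exists S0 S1,
     fitting_split br S M y S0 S1 /\ (\dim S0 < \dim S)%N)
  \/ (forall y, y \in vbasis X ->
        exists k, forall s, s \in S -> iter k (br^~ y) s = 0).
Proof.
move=> algS idM sMS abM sXM.
pose P y := exists S0 S1,
  fitting_split br S M y S0 S1 /\ (\dim S0 < \dim S)%N.
pose Q y := exists k, forall s, s \in S -> iter k (br^~ y) s = 0.
have [y yX|[y yX [S0 [S1 [? ?]]]]|nil] :=
  @seq_dichotomy _ P Q (vbasis X); last first.
- by right.
- by left; exists y; [exact: vbasis_mem | exists S0, S1].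
have yM : y \in M by apply: (subvP sXM); apply: vbasis_mem.
have [S0 [S1 [n [fS nS]]]] := metabelian_fitting brL algS idM sMS abM yM.
have [S10|nz] := eqVneq S1 0%VS.
  by right; exists n => s /nS; rewrite S10 memv0 => /eqP.
left; exists S0, S1; split=> //.
rewrite -(fs_sum fS) dimv_disjoint_sum ?(fs_cap fS) // -[X in (X < _)%N]addn0.
by rewrite ltn_add2l lt0n dimv_eq0.
Qed.

(** One bracket takes M' + C into M', on which M' acts as zero; from there on only C acts, by
    commuting nilpotent maps. *)
Lemma nilpotent_addv M C :
  (lbrv br M M <= M)%VS -> lbrv br (lbrv br M M) (lbrv br M M) = 0%VS ->
  (C <= M)%VS ->
  (forall y, y \in vbasis C ->
     exists k, forall a, a \in lbrv br M M -> iter k (br^~ y) a = 0) ->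
  nilpotent br (lbrv br M M + C)%VS.
Proof.
move=> sMM abM sCM nilC; set A := lbrv br M M in sMM abM nilC *.
have XM x : x \in vbasis C -> x \in M.
  by move=> /vbasis_mem; apply: subvP.
have [x a /XM xM aA|x y a /XM xM /XM yM aA||k k0] :=
    commuting_nilpotent (X := vbasis C) (A := A) brL.
- by rewrite memv_lbrv // (subvP sMM).
- exact: (rbr_comm (M := M) brL abM xM yM aA).
- exact: nilC.
rewrite (span_basis (vbasisP C)) in k0.
exists k.+1; rewrite /lower_central iterSr; apply/eqP; rewrite -subv0 -k0.
have sN : (A + C <= M)%VS by rewrite subv_add sMM.
elim: (k) => [|j IH] /=; first by rewrite subv_lbrv.
have sjA : (iter j (fun V => lbrv br V C) A <= A)%VS.
  elim: (j) => //= i IHi; apply: subv_trans (subv_lbrv brL IHi (subvv C)) _.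
  by rewrite subv_lbrv.
apply/(lbrvP brL) => u v /(subvP IH) uj /memv_addP[a aA [c cC ->]].
rewrite (lbrDr brL) memvD ?[br u c \in _]memv_lbrv //.
have /eqP/(lbrv0P brL)-> := abM; [exact: mem0v | | by []].
exact: subvP uj.
Qed.

Lemma relative_idealS S S0 M :
  subalgebra br S0 -> (S0 <= S)%VS -> relative_ideal br S M ->
  relative_ideal br S0 (M :&: S0).
Proof.
move=> alg0 /subvP s0 idM x u xS0; rewrite !memv_cap => /andP[uM uS0].
by have [-> ->] := idM x u (s0 _ xS0) uM; rewrite !alg0.
Qed.

Lemma relative_ideal_lbrv S I :
  relative_ideal br S I -> relative_ideal br S (lbrv br I I).
Proof.
move=> idI x w xS; move: w.
apply: lbrv_ind => [|a u v [xu ux] [xv vx]|u v Iu Iv].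
- by rewrite (lbr0l brL) (lbr0r brL) mem0v.
- by rewrite (lbrDl brL) (lbrDr brL) (lbrZl brL) (lbrZr brL) !memvD ?memvZ.
have [xu ux] := idI x u xS Iu; have [xv vx] := idI x v xS Iv; split.
  by rewrite (lbr_identity brL) memvB // memv_lbrv.
by rewrite rbr_derivation // memvD // memv_lbrv.
Qed.

Lemma relative_ideal_sub S M :
  relative_ideal br S M -> (M <= S)%VS -> (lbrv br M M <= M)%VS.
Proof.
move=> idM /subvP sMS; apply/(lbrvP brL) => u v uM /sMS vS.
by have [] := idM v u vS uM.
Qed.

Hypothesis AL : A_algebra br.

Lemma metabelian_ideal_splits S M :
  subalgebra br S -> relative_ideal br S M -> (M <= S)%VS ->
  lbrv br (lbrv br M M) (lbrv br M M) = 0%VS ->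
  (exists B, [/\ subalgebra br B, (lbrv br M M + B = S)%VS
     & (lbrv br M M :&: B = 0)%VS])
  /\ forall x, x \in lbrv br M M -> (forall y, y \in M -> br x y = 0) -> x = 0.
Proof.
have [n] := ubnP (\dim S); elim: n S M => // n IH S M ltn algS idM sMS abM.
have sMM := relative_ideal_sub idM sMS.
have [[y yM [S0 [S1 [fS lt]]]]|nil] :=
  fitting_dichotomy algS idM sMS abM (subvv M); last first.
  have : nilpotent br M.
    (* M is written as M' + M. *)
    rewrite -(addv_idPr sMM); apply: nilpotent_addv => // y /nil[k nk].
    by exists k => a aM; rewrite nk // (subvP sMS) // (subvP sMM).
  move/AL => abM'; have -> : lbrv br M M = 0%VS.
    apply/eqP/(lbrv0P brL); apply: abM' => u v uM vM.
    by rewrite (subvP sMM) // memv_lbrv.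
  split; last by move=> x; rewrite memv0 => /eqP.
  by exists S; rewrite add0v cap0v.
have s0 : (S0 <= S)%VS by rewrite -(fs_sum fS) addvSl.
have [|||||[B [algB B0 BI0]] nz] := IH S0 (M :&: S0)%VS.
- exact: leq_trans lt _.
- exact: fs_sub fS.
- exact: relative_idealS (fs_sub fS) s0 idM.
- exact: capvSr.
- by apply/eqP; rewrite -subv0 -abM !subv_lbrv ?capvSl.
have [Bs Bc] := direct_trans B0 BI0 (fs_sum fS) (fs_cap fS).
rewrite (fs_lbrv fS) in Bs Bc.
split=> [|x xM x0]; first by exists B.
apply: nz => [|z]; last by rewrite memv_cap => /andP[/x0].
(* Since [x, y] = 0, x lies in S0, and M' meets S0 exactly in (M :&: S0)'. *)
apply: (@direct_mem _ _ _ S0 S1); rewrite ?(fs_cap fS) ?(fs_lbrv fS) //.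
  by apply: subv_trans (addvSl _ B) _; rewrite B0.
apply/(fs_null fS); split; first by rewrite (subvP sMS) // (subvP sMM).
by exists 1%N; apply: x0.
Qed.

Lemma metabelian_cartan_complement S C :
  subalgebra br S -> lbrv br (lbrv br S S) (lbrv br S S) = 0%VS ->
  (C <= S)%VS -> abelian br C ->
  (forall x, x \in S -> in_normaliser br C x -> x \in C) ->
  (lbrv br S S + C = S)%VS /\ (lbrv br S S :&: C = 0)%VS.
Proof.
have [n] := ubnP (\dim S); elim: n S => // n IH S ltn algS abS sCS abC nC.
have idS : relative_ideal br S S by move=> x u xS uS; rewrite !algS.
have [[y yC [S0 [S1 [fS lt]]]]|nil] :=
  fitting_dichotomy algS idS (subvv S) abS sCS.
  have s0 : (S0 <= S)%VS by rewrite -(fs_sum fS) addvSl.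
  have [||||||B0 BI0] := IH S0.
  - exact: leq_trans lt _.
  - exact: fs_sub fS.
  - by apply/eqP; rewrite -subv0 -abS !subv_lbrv.
  - apply/subvP=> c cC; apply/(fs_null fS); split; first exact: subvP cC.
    by exists 1%N; apply: abC.
  - by [].
  - by move=> x xS0; apply: nC; apply: subvP xS0.
  have := direct_trans B0 BI0 (fs_sum fS) (fs_cap fS).
  by rewrite -[in lbrv br S0 S0](capv_idPr s0) (fs_lbrv fS).
have sSS : (lbrv br S S <= S)%VS by apply/(lbrvP brL) => u v; apply: algS.
have abN : abelian br (lbrv br S S + C)%VS.
  have sN : (lbrv br S S + C <= S)%VS by rewrite subv_add sSS.
  apply: AL; last first.
    apply: nilpotent_addv => // y /nil[k nk].
    by exists k => a aS; rewrite nk // (subvP sSS).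
  move=> x y /(subvP sN) xS /(subvP sN) yS.
  by rewrite (subvP (addvSl _ _)) // memv_lbrv.
(* As S' + C is abelian, S' normalises C; once S' lies in C, all of S normalises C. *)
have sSC : (lbrv br S S <= C)%VS.
  apply/subvP=> a aS; apply: nC => [|c cC]; first exact: subvP aS.
  have aN := subvP (addvSl _ C) _ aS.
  have cN := subvP (addvSr (lbrv br S S) _) _ cC.
  by rewrite !abN ?mem0v.
have eSC : S = C.
  apply/eqP; rewrite eqEsubv sCS andbT; apply/subvP=> x xS.
  by apply: nC => // c /(subvP sCS) cS; rewrite !(subvP sSC) // memv_lbrv.
have -> : lbrv br S S = 0%VS by rewrite eSC; apply/eqP/(lbrv0P brL).
by rewrite add0v cap0v.
Qed.

Lemma metabelian_cartanP C :
  derived br 2 = 0%VS ->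
  cartan br C <-> subalgebra br C /\ complementary (derived br 1) C.
Proof.
move=> ab2; have algL : subalgebra br fullv by move=> x y _ _; apply: memvf.
split=> [[algC nilC nC]|[algC [sC cC]]].
  split=> //; apply: (metabelian_cartan_complement algL ab2 (subvf C)).
    exact: AL.
  by move=> x _ /nC.
have abC : abelian br C.
  move=> x y xC yC; apply/eqP; rewrite -memv0 -cC memv_cap algC //.
  by rewrite memv_lbrv ?memvf.
split=> // [|x]; first by exists 1%N; apply/eqP/(lbrv0P brL).
split=> [xC c cC'|nx]; first by rewrite !abC ?mem0v.
have := memvf x; rewrite -sC => /memv_addP[a aA [c cC' xE]].
have [_ nz] := metabelian_ideal_splits algL (M := fullv)
  (fun x u _ _ => conj (memvf _) (memvf _)) (subvv _) ab2.
(* It remains to see that a kills y = b + d: [a, b] = 0 since L' is abelian, and [a, d] = [x, d]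
   lies in both L' and C. *)
rewrite xE (nz a) ?add0r // => y _.
have := memvf y; rewrite -sC => /memv_addP[b bA [d dC ->]].
rewrite (lbrDr brL); have /eqP/(lbrv0P brL)-> := ab2; rewrite ?add0r //.
apply/eqP; rewrite -memv0 -cC memv_cap; apply/andP; split.
  by rewrite memv_lbrv ?memvf.
have -> : br a d = br x d by rewrite xE (lbrDl brL) (abC c) ?addr0.
by have [] := nx d dC.
Qed.

End MetabelianAalgebra.

(** * Splitting over all derived terms *)

Section DerivedSeries.
Variables (F : fieldType) (L : vectType F) (br : L -> L -> L).
Hypothesis brL : leibniz_bracket br.
Implicit Types (x y z : L) (A B C I J M N S U V W : {vspace L}).

(** Convertible to [derived br k] when S is [fullv]; an arbitrary start is needed because the
    induction passes to complements. *)
Definition derived_of S k : {vspace L} := iter k (fun V => lbrv br V V) S.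

Lemma derived_ofS S T k :
  (S <= T)%VS -> (derived_of S k <= derived_of T k)%VS.
Proof. by move=> sST; elim: k => //= k IH; rewrite subv_lbrv. Qed.

Lemma derived_of_ideal S k :
  subalgebra br S ->
  relative_ideal br S (derived_of S k) /\ (derived_of S k <= S)%VS.
Proof.
move=> algS; elim: k => [|k [idS sS]].
  by split=> // x u xS uS; rewrite !algS.
split; first exact: (relative_ideal_lbrv brL idS).
exact: subv_trans (relative_ideal_sub brL idS sS) sS.
Qed.

Lemma derived_of_anti S m n :
  subalgebra br S -> (m <= n)%N -> (derived_of S n <= derived_of S m)%VS.
Proof.
move=> algS /subnK<-; elim: (n - m)%N => // k IH; apply: subv_trans IH.
have [idS sS] := derived_of_ideal (k + m) algS.
exact: (relative_ideal_sub brL idS sS).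
Qed.

Hypothesis AL : A_algebra br.

Lemma derived_of_splits n S i :
  subalgebra br S -> derived_of S n = 0%VS ->
  exists B, [/\ subalgebra br B, (B <= S)%VS, (derived_of S i + B = S)%VS
              & (derived_of S i :&: B = 0)%VS].
Proof.
elim: n S => [|n IH] S algS Sn.
  exists 0%VS; rewrite addv0 capv0 sub0v; split=> //.
    by move=> x y; rewrite !memv0 => /eqP-> _; rewrite (lbr0l brL).
  have [_] := derived_of_ideal i algS.
  by rewrite [X in (_ <= X)%VS](Sn : S = _) subv0 => /eqP->;
     rewrite (Sn : S = _).
have [lt|ge] := ltnP i n.+1; last first.
  exists S; have -> : derived_of S i = 0%VS.
    by apply/eqP; rewrite -subv0 -Sn derived_of_anti.
  by rewrite add0v cap0v.
case: n => [|n] in IH Sn lt *.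
  case: i IH lt => // _ _; exists 0%VS; rewrite addv0 capv0 sub0v; split=> //.
  by move=> x y; rewrite !memv0 => /eqP-> _; rewrite (lbr0l brL).
have [idM sMS] := derived_of_ideal n algS.
have [[B [algB JB JB0]] _] := metabelian_ideal_splits brL AL algS idM sMS Sn.
rewrite -/(derived_of S n.+1) in JB JB0; set J := derived_of S n.+1 in JB JB0.
have sBS : (B <= S)%VS by rewrite -JB addvSr.
have [idJ sJS] : relative_ideal br S J /\ (J <= S)%VS.
  exact: derived_of_ideal.
have [||D [algD sDB BD BD0]] := IH B => //.
  apply/eqP; rewrite -subv0 -JB0 subv_cap derived_ofS //=.
  by have [] := derived_of_ideal n.+1 algB.
have [] := direct_trans BD BD0 (W := J) (S := S).
- by rewrite addvC.
- by rewrite capvC.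
(* Modulo the ideal J, the algebras S and B have the same derived series. *)
have -> : (derived_of B i + J = derived_of S i)%VS; last first.
  by move=> ? ?; exists D; split=> //; apply: subv_trans sBS.
apply/eqP; rewrite eqEsubv subv_add derived_ofS // derived_of_anti //=.
elim: (i) => [|j IHj] /=; first by rewrite addvC JB.
apply: subv_trans (subv_lbrv brL IHj IHj) _.
have BjS x : x \in derived_of B j -> x \in S.
  have [_ sBj] := derived_of_ideal j algB.
  by move=> xB; apply: (subvP sBS); apply: subvP xB.
apply/(lbrvP brL) => _ _ /memv_addP[b bB [x xJ ->]] /memv_addP[c cB [y yJ ->]].
rewrite (lbrDl brL) !(lbrDr brL) -addrA memv_add ?memv_lbrv //.
have yS := subvP sJS _ yJ.
by rewrite !memvD //; [have [] := idJ b y (BjS _ bB) yJ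
  | have [] := idJ c x (BjS _ cB) xJ | have [] := idJ y x yS xJ].
Qed.

End DerivedSeries.

(** * Transfer of the A-property to subquotients *)

Section Transport.
Variables (F : fieldType) (L Q : vectType F).
Variables (br : L -> L -> L) (brQ : Q -> Q -> Q) (f : {linear L -> Q}).
Variable B : {vspace L}.
Hypotheses (brL : leibniz_bracket br) (brQL : leibniz_bracket brQ).
Hypothesis algB : subalgebra br B.
Hypothesis f_br :
  forall x y, x \in B -> y \in B -> f (br x y) = brQ (f x) (f y).
Hypothesis f_inj : forall x, x \in B -> f x = 0 -> x = 0.
Hypothesis f_surj : forall q, exists2 x, x \in B & f x = q.

(** f restricts to an isomorphism from B onto Q, so a nilpotent subalgebra of Q pulls back to a
    nilpotent one inside B. *)
Lemma A_algebra_iso : A_algebra br -> A_algebra brQ.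
Proof.
move=> AL N algN [k nilN].
pose NB := (linfun f @^-1: N :&: B)%VS.
have NBE x : (x \in NB) = (f x \in N) && (x \in B).
  by rewrite memv_cap -memv_preim lfunE.
have algNB : subalgebra br NB.
  move=> x y; rewrite !NBE => /andP[xN xB] /andP[yN yB].
  by rewrite f_br // algN // algB.
have abNB : abelian br NB.
  apply: AL => //; exists k; apply/eqP; rewrite -subv0; apply/subvP => x xk.
  have [xB fx] : x \in B /\ f x \in lower_central brQ N k.
    elim: (k) x xk => [|j IH] /=; first by move=> x; rewrite NBE => /andP[].
    apply: lbrv_ind => [|a u v [uB fu] [vB fv]|u v /IH[uB fu]].
    - by rewrite linear0 !mem0v.
    - by rewrite linearP !memvD // memvZ.
    by rewrite NBE => /andP[vN vB]; rewrite algB // f_br // memv_lbrv.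
  rewrite memv0; apply/eqP/f_inj => //; apply/eqP.
  by rewrite -memv0 -nilN.
move=> p q; have [x xB <-] := f_surj p; have [y yB <-] := f_surj q.
by move=> xN yN; rewrite -f_br // abNB ?linear0 // NBE ?xN ?yN.
Qed.

End Transport.

Section SubquotientProjection.
Variables (F : fieldType) (L : vectType F) (br : L -> L -> L).
Variables U I : {vspace L}.
Hypotheses (brL : leibniz_bracket br).
Hypotheses (algU : subalgebra br U) (idI : ideal br I).

(** Projecting onto U first makes the map total and linear on L; it is the canonical map only on
    U. *)
Definition subquo_pi (x : L) : subquo U I := quotv_pi _ (vsproj U x).

Fact subquo_pi_linear : linear subquo_pi.
Proof. by move=> a x y; rewrite /subquo_pi !linearP. Qed.
HB.instance Definition _ :=
  GRing.isSemilinear.Build F L (subquo U I) _ subquo_pi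
    (GRing.semilinear_linear subquo_pi_linear).

Lemma subquo_pi_eq0 x : x \in U -> (subquo_pi x == 0) = (x \in I).
Proof. by move=> xU; rewrite quotv_pi_eq0 mem_subv_in vsprojK. Qed.

Lemma subquo_pi_br x y :
  x \in U -> y \in U ->
  subquo_pi (br x y) = subquo_br br U I (subquo_pi x) (subquo_pi y).
Proof.
move=> xU yU; rewrite /subquo_br /subquo_pi quotv_pi_br.
- by rewrite /sub_br !vsprojK.
- exact: sub_br_leibniz.
exact: subv_in_ideal.
Qed.

Lemma subquo_pi_surj q : exists2 x, x \in U & subquo_pi x = q.
Proof.
exists (vsval (repr q)); first exact: subvsP.
by rewrite /subquo_pi vsvalK quotv_reprK.
Qed.

Lemma mem_subquo_img (W : {vspace L}) q :
  (W <= U)%VS ->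
  reflect (exists2 x, x \in W & subquo_pi x = q) (q \in subquo_img U I W).
Proof.
move=> /subvP sWU; apply: (iffP (mem_quotv_img (subv_in U W) q)).
  move=> [x xW ->].
  by exists (vsval x); rewrite -?mem_subv_in // /subquo_pi vsvalK.
by move=> [x xW <-]; exists (vsproj U x); rewrite // mem_subv_in vsprojK ?sWU.
Qed.

Lemma subquo_img_lbrv W :
  (W <= U)%VS -> (lbrv br W W <= W)%VS ->
  lbrv (subquo_br br U I) (subquo_img U I W) (subquo_img U I W)
    = subquo_img U I (lbrv br W W).
Proof.
move=> sWU sWW; have brQ := subquo_br_leibniz brL algU idI.
have sWWU := subv_trans sWW sWU.
apply/eqP; rewrite eqEsubv; apply/andP; split.
  apply/(lbrvP brQ) => p q /(mem_subquo_img _ sWU)[x xW <-].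
  move=> /(mem_subquo_img _ sWU)[y yW <-]; apply/mem_subquo_img => //.
  by exists (br x y); [rewrite memv_lbrv | rewrite subquo_pi_br ?(subvP sWU)].
apply/subvP => q /(mem_subquo_img _ sWWU)[x xW <-].
move: x xW; apply: lbrv_ind => [|a u v Pu Pv|u v uW vW].
- by rewrite linear0 mem0v.
- by rewrite linearP memvD // memvZ.
rewrite subquo_pi_br ?(subvP sWU) // memv_lbrv //; apply/mem_subquo_img => //.
  by exists u.
by exists v.
Qed.

Lemma subquo_imgT : subquo_img U I U = fullv.
Proof.
apply/eqP; rewrite eqEsubv subvf /=; apply/subvP => q _.
by have [x xU xq] := subquo_pi_surj q; apply/mem_subquo_img => //; exists x.
Qed.

Lemma subquo_img0 : subquo_img U I I = 0%VS.
Proof.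
apply/eqP; rewrite -subv0; apply/subvP => q /mem_quotv_img[x xI ->].
by rewrite memv0 quotv_pi_eq0.
Qed.

(** The preimage of a nilpotent subalgebra of U / I need not be nilpotent, so the complement B,
    isomorphic to U / I, is used instead. *)
Lemma subquo_A_algebra B :
  A_algebra br -> subalgebra br B -> (B <= U)%VS -> (I + B = U)%VS ->
  (I :&: B = 0)%VS -> A_algebra (subquo_br br U I).
Proof.
move=> AL algB /subvP sBU IB IB0.
have sIU : (I <= U)%VS by rewrite -IB addvSl.
apply: (@A_algebra_iso _ _ _ br _ subquo_pi B) => //.
- exact: subquo_br_leibniz.
- by move=> x y /sBU xU /sBU yU; apply: subquo_pi_br.
- move=> x xB /eqP; rewrite subquo_pi_eq0 ?sBU // => xI.
  by apply/eqP; rewrite -memv0 -IB0 memv_cap xI.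
move=> q; have [x xU <-] := subquo_pi_surj q.
have /memv_addP[i iI [b bB ->]] : x \in (I + B)%VS by rewrite IB.
have i0 : subquo_pi i = 0 by apply/eqP; rewrite subquo_pi_eq0 // (subvP sIU).
by exists b; rewrite // linearD /= i0 add0r.
Qed.

End SubquotientProjection.

Theorem theorem3p2 (F : fieldType) (L : vectType F) (br : L -> L -> L)
    (brL : leibniz_bracket br) (solL : solvable br) (AL : A_algebra br) :
  (forall i : nat, exists B : {vspace L},
     subalgebra br B /\ complementary (derived br i) B) /\
  (forall (i : nat) (C : {vspace subquo (derived br i) (derived br i.+2)}),
     cartan (subquo_br br (derived br i) (derived br i.+2)) C <->
     subalgebra (subquo_br br (derived br i) (derived br i.+2)) C /\
     complementary
       (subquo_img (derived br i) (derived br i.+2) (derived br i.+1)) C).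
Proof.
have [n Ln] := solL.
split=> i.
  have [x y _ _||B [algB _ sB cB]] := @derived_of_splits _ _ br brL AL n fullv i.
  - exact: memvf.
  - by [].
  by exists B.
set U := derived br i; set I := derived br i.+2.
have algU : subalgebra br U := derived_subalgebra brL (k := i).
have idI : ideal br I := derived_ideal brL (k := i.+2).
(* The second derived term of U is [I] by computation, so B is a complement of [I] in U. *)
have [|B [algB sBU IB IB0]] := @derived_of_splits _ _ br brL AL n U 2 algU.
  by apply/eqP; rewrite -subv0 -Ln derived_ofS // subvf.
have sUU : (lbrv br U U <= U)%VS := derivedS brL i.
have sI : (I <= derived br i.+1)%VS := derivedS brL i.+1.
have AQ := subquo_A_algebra brL algU idI AL algB sBU IB IB0.
have d1 : derived (subquo_br br U I) 1 = subquo_img U I (derived br i.+1).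
  by rewrite -(subquo_img_lbrv brL algU idI (subvv U)) // subquo_imgT.
move=> C; rewrite -d1; apply: metabelian_cartanP => //.
  exact: subquo_br_leibniz.
rewrite [LHS](congr1 (fun V => lbrv _ V V) d1) subquo_img_lbrv //.
exact: subquo_img0.
Qed.
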